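(* Kulesza's space $Z$ cannot be embedded (as a topological subspace) in any metrizable topological group $G$ with $\operatorname{ind} G=0$.
   Context: $\operatorname{ind}$ is the small inductive dimension. Let $L$ be the set of all (nonzero) limit ordinals smaller than $\omega_1$, and for $k\in\omega$ let $L+k=\{\alpha+k:\alpha\in L\}$; thus $\omega_1=\omega\cup\bigcup_{k\in\omega}(L+k)$. Kulesza's space $Z\subset\omega_1^\omega$ is the set of all sequences $\boldsymbol{a}=a_0a_1\dots\in\omega_1^\omega$ such that $a_0\in\omega_1\setminus L$, $a_k\in L$ for at most one $k\in\omega$, and if $a_k\in L$, then $a_{k+1}=a_k+k$ and $a_{k+i}\in L+k$ for all $i\ge 2$. The topology of $Z$ is induced by the product topology on $\omega_1^\omega$, where each factor $\omega_1$ has the usual order topology. *)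

(* Defs.v *)
From HB Require Import structures.
From mathcomp Require Import all_boot all_order all_algebra.
From mathcomp Require Import all_classical all_reals all_analysis.
From mathcomp Require wochoice.

Set Implicit Arguments.
Unset Strict Implicit.
Unset Printing Implicit Defensive.

Import Order.TTheory GRing.Theory Num.Theory.

Local Open Scope classical_set_scope.

(* Up to order isomorphism, omega_1 is the only uncountable well-order all of
   whose proper initial segments are countable. *)
Definition is_omega1 {d} (W : orderType d) : Prop :=
  [/\ wochoice.well_order (<=%O : rel W),
      ~ countable [set: W]
    & forall x : W, countable [set y : W | (y < x)%O]].

Section Ordinals.
Context {d} {W : orderType d}.

(* The least element above x (in omega_1 it always exists, see osuccP). *)
Definition osucc (x : W) : W :=
  xget x [set y | (x < y)%O /\ forall z, (x < z)%O -> (y <= z)%O].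

(* The ordinal x + k, for a finite k. *)
Definition oadd (x : W) (k : nat) : W := iter k osucc x.

(* L: the elements that are neither zero nor a successor. *)
Definition limit_ordinals : set W :=
  [set x | (exists y, (y < x)%O) /\
           forall y, (y < x)%O -> exists z, (y < z < x)%O].

(* L + k *)
Definition limit_plus (k : nat) : set W := oadd^~ k @` limit_ordinals.

End Ordinals.

Definition Kulesza {d} (W : orderTopologicalType d) : set {ptws nat -> W} :=
  [set a | [/\ ~ limit_ordinals (a 0),
      forall j k, limit_ordinals (a j) -> limit_ordinals (a k) -> j = k
    & forall k, limit_ordinals (a k) ->
        a k.+1 = oadd (a k) k /\
        forall i, (2 <= i)%N -> limit_plus k (a (k + i)%N)]].

Arguments Kulesza {d} W _.

Definition boundary {X : topologicalType} (A : set X) : set X :=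
  closure A `\` interior A.

(* ind_lt n X says that ind X < n, i.e. ind X <= n - 1; the shift by one makes
   room for ind X = -1, which holds exactly when X is empty. *)
Fixpoint ind_lt (n : nat) (X : topologicalType) : Prop :=
  if n is m.+1 then
    forall (x : X) (U : set X), open U -> U x ->
      exists V : set X,
        [/\ open V, V x, V `<=` U & ind_lt m (set_type (boundary V))]
  else [set: X] = set0.

Definition ind_eq (X : topologicalType) (n : nat) : Prop :=
  ind_lt n.+1 X /\ ~ ind_lt n X.

Definition metrizable (R : realType) (X : topologicalType) : Prop :=
  exists dist : X -> X -> R,
    [/\ forall x y, dist x y = 0%R <-> x = y,
        forall x y, dist x y = dist y x,
        forall x y z, (dist x z <= dist x y + dist y z)%R
      & forall (x : X) (A : set X), nbhs x A <->
          exists2 e : R, (0 < e)%R & [set y | (dist x y < e)%R] `<=` A].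

Definition embedding {X Y : topologicalType} (f : X -> Y) : Prop :=
  [/\ injective f, continuous f
    & forall U : set X, open U ->
        exists2 V : set Y, open V & f @` U = range f `&` V].

HB.mixin Record isTopologicalGroup G & Topological G & Group G := {
  mulg_continuous : continuous (fun x : G * G => (x.1 * x.2)%g);
  invg_continuous : continuous (fun x : G => (x^-1)%g)
}.

#[short(type="topologicalGroupType")]
HB.structure Definition TopologicalGroup :=
  {G of Topological G & Group G & isTopologicalGroup G}.

Lemma countableU1 T (A : set T) (x : T) :
  countable A -> countable (A `|` [set x]).
Proof.
move=> cA; rewrite -bigcup2E; apply: bigcup_countable => // -[|[|n]] _ //=.
Qed.

Lemma omega1_min {d} (W : orderType d) (A : set W) : is_omega1 W -> A !=set0 ->
  exists2 x, A x & forall y, A y -> (x <= y)%O.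
Proof.
move=> [wo _ _] [a Aa].
have [|x [[xA xmin] _]] := wo (mem A).
  by exists a; rewrite inE.
exists x; first by move: xA; rewrite inE.
by move=> y Ay; apply: xmin; rewrite inE.
Qed.

Lemma osuccP {d} (W : orderType d) (x : W) : is_omega1 W ->
  (x < osucc x)%O /\ forall z, (x < z)%O -> (osucc x <= z)%O.
Proof.
move=> W1; suff [y Py] : [set y | (x < y)%O /\
    forall z, (x < z)%O -> (y <= z)%O] !=set0 by exact: (xgetI x Py).
have [|y xy ymin] := @omega1_min _ _ [set y | (x < y)%O] W1; last first.
  by exists y.
apply/set0P/negP => /eqP x_max; case: W1 => _ unc seg; apply: unc.
apply: (@sub_countable _ _ _ ([set y | (y < x)%O] `|` [set x])).
  apply: subset_card_le => y _ /=; case: (ltgtP y x) => [||->]; [by left| |by right].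
  by move=> xy; have : set0 y by rewrite -x_max.
exact: countableU1 (seg x).
Qed.

(* Inside a well-order of the subsets of nat, omega_1 is the set of the elements
   that have countably many predecessors. *)
Lemma omega1_exists :
  exists (d : Order.disp_t) (W : orderTopologicalType d), is_omega1 W.
Proof.
pose T : choiceType := set nat.
have T_uncountable : ~ countable [set: T].
  move=> /countable_injP[f finj].
  pose D : T := [set n | exists2 A : T, f A = n & ~ A n].
  have DN : ~ D (f D).
    move=> DfD; case: (DfD) => A fA; apply.
    by have -> : A = D by apply: finj; rewrite ?inE.
  by apply: (DN); exists D.
have [R woR] := wochoice.well_ordering_principle T.
have Rtot : total R.
  by move=> x y; apply: (wochoice.wo_chainW (wochoice.withinW woR)).
have Ranti : antisymmetric R.
  by move=> x y; apply: (wochoice.wo_chain_antisymmetric (wochoice.withinW woR)).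
have Rmin (A : set T) : A !=set0 -> exists2 x, A x & forall y, A y -> R x y.
  move=> [a Aa]; have [|x [[xA xmin] _]] := woR (mem A).
    by exists a; rewrite inE.
  by exists x; [move: xA; rewrite inE | move=> y Ay; apply: xmin; rewrite inE].
have Rxx : reflexive R by move=> x; have := Rtot x x; rewrite orbb.
have Rtrans : transitive R.
  move=> y x z Rxy Ryz.
  have [|u xyzu umin] := Rmin [set u | [\/ u = x, u = y | u = z]].
    by exists x; constructor 1.
  have ux : R u x by apply: umin; constructor 1.
  have uy : R u y by apply: umin; constructor 2.
  have uz : R u z by apply: umin; constructor 3.
  case: xyzu => ?; subst u => //.
    by have -> : x = y by apply: Ranti; rewrite Rxy.
  by have <- : y = z by apply: Ranti; rewrite Ryz.
pose P : pred T := fun x => `[< countable [set y | R y x] >].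
pose S : choiceType := {x : T | P x}.
pose le : rel S := fun x y => R (val x) (val y).
have le_refl : reflexive le by move=> x; exact: Rxx.
have le_anti : antisymmetric le.
  by move=> x y /Ranti; exact: val_inj.
have le_trans : transitive le by move=> x y z; exact: Rtrans.
have le_total : total le by move=> x y; exact: Rtot.
pose PO : porderType Order.default_display := HB.pack (Choice.sort S)
  (Choice.class S)
  (Order.Le_isPOrder.Build Order.default_display S le_refl le_anti le_trans).
pose W : orderType Order.default_display := HB.pack (Order.POrder.sort PO)
  (Order.POrder.class PO) (Order.POrder_isTotal.Build _ PO le_total).
exists Order.default_display, (order_topology W).
split.
- apply: wochoice.antisymmetric_well_order => [|A [a Aa]]; first exact: le_anti.
  have [|x /= [Px xA] xmin] := Rmin [set x | exists Px : P x, exist _ x Px \in A].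
    by case: a Aa => a Pa Aa; exists a, Pa.
  exists (exist _ x Px); split=> // -[y Py] yA.
  by apply: xmin; exists Py.
- move=> cS; have cP : countable [set x | P x].
    apply: (@sub_countable _ _ _ (@setT S)); last exact: cS.
    have -> : [set x | P x] = val @` (@setT S).
      by apply/seteqP; split=> [x Px|_ [[x Px] _ <-]//]; exists (exist _ x Px).
    exact: card_image_le.
  apply: T_uncountable; suff : ~` [set x | P x] = set0.
    by move=> /(congr1 setC); rewrite setCK setC0 => <-.
  apply/seteqP; split=> // z nPz.
  have [|m /= nPm mmin] := Rmin (~` [set x | P x]); first by exists z.
  apply: nPm; apply/asboolP; apply: sub_countable (countableU1 m cP).
  apply: subset_card_le => y /= Rym.
  have [->|ym] := eqVneq y m; first by right.
  left; apply: contrapT => nPy; move/eqP: ym; apply.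
  by apply: Ranti; rewrite Rym mmin.
- move=> x; have /asboolP cx := valP x.
  have [f finj] := countable_injP _ cx.
  apply/countable_injP; exists (f \o val) => y z.
  rewrite !inE /= => yx zx fyz; apply: val_inj; apply: finj => //.
    by rewrite inE /=; apply: (ltW yx).
  by rewrite inE /=; apply: (ltW zx).
Qed.

(* Main.v *)
Require Import Defs.
From HB Require Import structures.
From mathcomp Require Import all_boot all_order all_algebra.
From mathcomp Require Import all_classical all_reals all_analysis.
Set Implicit Arguments.
Unset Strict Implicit.
Unset Printing Implicit Defensive.
Import Order.TTheory GRing.Theory Num.Theory.
Local Open Scope classical_set_scope.

(** If Z embeds by f in a metrizable group G with ind G = 0, then the identity
    of G is the only common point of countably many clopen sets V n, and the sets
    of the pairs (a, b) with (f a)^-1 * f b in V n are clopen in Z * Z and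
    intersect in the diagonal.  The theorem follows because no countable family
    of clopen subsets of Z * Z intersects in the diagonal
    (diagonal_not_clopen_intersection).

    Here is why.  Let E be a two-valued continuous function on Z * Z, and
    consider the pairs of sequences without limit coordinates.  After k > 0
    coordinates of both members are chosen, say that a value v is forced if some
    phi : omega_1 -> omega_1 exists such that E takes the value v at every
    continuation that grows faster than phi; the two members need not differ.
    The main point is that some value is always forced (nonlimit_decided).

    Suppose first that every one-step continuation forces a value
    (decided_step).  If both values occurred for arbitrarily large coordinates
    x at k, there would be a limit l, closed under all the countably many
    relevant functions below it, such that both values occur for x cofinal in l.
    Continue every pair by the same fast sequence l + k, c_2, c_3, ... with c_i
    in L + k.  Since only countably many x are below l, one sequence c can be
    fast for all of them, so both values are taken by E at these pairs for x
    cofinal in l.  But as x tends to l, these pairs converge in Z * Z to the pair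
    with l at k: this is what the tails L + k in the definition of Z are for.
    So E would be discontinuous at that limit.
    If on the other hand the prefix forces nothing, then by this step it extends
    to a pair of infinite sequences none of whose prefixes forces a value,
    although E is constant near that pair (locally_constant).

    If E holds on the diagonal, the forced value at any common first coordinate
    is true, because diagonal pairs may be fast.  For countably many such E, one
    pair of distinct sequences is fast for all of them at once, and lies in every
    one of the clopen sets. *)

(** * Convergence of sequences *)

Lemma cvg_ptws (T : topologicalType) (u : nat -> {ptws nat -> T})
    (a : {ptws nat -> T}) :
  (forall j, (fun n => u n j) @ \oo --> a j) -> u @ \oo --> a.
Proof.
move=> ua; apply/cvg_sup => j V [U [] [] O oO <- Oa OV].
by apply: filterS OV _; apply: (ua j); exact: open_nbhs_nbhs.
Qed.

Lemma cvg_set_type (T : topologicalType) (A : set T) (u : nat -> set_type A)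
    (a : set_type A) :
  (fun n => set_val (u n)) @ \oo --> set_val a -> u @ \oo --> a.
Proof.
move=> ua V [U [] [] O oO <- Oa OV].
by apply: filterS OV _; apply: ua; exact: open_nbhs_nbhs.
Qed.

(** * Suprema, limits and fast sequences in omega_1 *)

Section Omega1.
Context {d : Order.disp_t} {W : orderTopologicalType d} (hW : is_omega1 W).

Lemma countable_bounded (A : set W) : countable A ->
  exists u, forall x, A x -> (x < u)%O.
Proof.
move=> cA; apply: contrapT => noub; case: hW => _ + seg; apply.
apply: (@sub_countable _ _ _ (\bigcup_(x in A) ([set y | (y < x)%O] `|` [set x]))).
  apply: subset_card_le => u _; apply: contrapT => nu.
  apply: noub; exists u => x Ax; rewrite ltNge; apply/negP => ux.
  apply: nu; exists x => //=; move: ux; rewrite le_eqVlt.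
  by case/orP => [/eqP|]; [right|left].
by apply: bigcup_countable => // x _; exact: countableU1.
Qed.

Lemma countable_ubound (I : countType) (h : I -> W) :
  exists u, forall i, (h i < u)%O.
Proof.
have [|u hu] := @countable_bounded (range h).
  by apply: sub_countable (countableP [set: I]); exact: card_image_le.
by exists u => i; apply: hu; exists i.
Qed.

Lemma osucc_gt (x : W) : (x < osucc x)%O.
Proof. by case: (osuccP x hW). Qed.

Lemma oadd_ge (x : W) k : (x <= oadd x k)%O.
Proof.
elim: k => //= k IHk; exact: le_trans IHk (ltW (osucc_gt _)).
Qed.

Lemma osucc_nonlimit (x : W) : ~ limit_ordinals (osucc x).
Proof.
case=> _ /(_ _ (osucc_gt x))[z /andP[xz]].
by rewrite ltNge (proj2 (osuccP x hW)).
Qed.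

Lemma limit_plus_nonlimit k (x : W) : (0 < k)%N -> limit_plus k x ->
  ~ limit_ordinals x.
Proof. by case: k => // k _ [y _ <-]; exact: osucc_nonlimit. Qed.

(** Iterating a function that dominates Psi and the successor gives a sequence
    whose supremum l is a limit; g is kept because it makes the closure of l
    under Psi quantitative and gives sequences converging to l. *)
Lemma limit_closing (Psi : W -> W) (x0 : W) :
  exists (g : nat -> W) (l : W), [/\ limit_ordinals l, (x0 < l)%O,
    forall n, (Psi (g n) <= g n.+1)%O, forall n, (g n < l)%O
    & forall x, (x < l)%O -> exists n, (x <= g n)%O].
Proof.
pose g n := iter n (fun x => Order.max (Psi x) (osucc x)) x0.
have gS n : (g n < g n.+1)%O by rewrite /= lt_max osucc_gt orbT.
have [l gl lmin] : exists2 l, (forall n, (g n < l)%O) &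
    forall u, (forall n, (g n < u)%O) -> (l <= u)%O.
  by apply: omega1_min => //; exact: countable_ubound.
have below x : (x < l)%O -> exists n, (x <= g n)%O.
  move=> xl; apply: contrapT => ng; move: xl; rewrite ltNge => /negP; apply.
  by apply: lmin => n; rewrite ltNge; apply/negP => xg; apply: ng; exists n.
exists g, l; split => //.
- split; first by exists x0; exact: (gl 0).
  move=> x /below[n xg]; exists (g n.+1).
  by rewrite gl (le_lt_trans xg (gS n)).
- exact: (gl 0).
- by move=> n; rewrite /= le_max lexx.
Qed.

Lemma limit_plus_unbounded k (u : W) : exists2 x, limit_plus k x & (u < x)%O.
Proof.
have [_ [l [Ll ul _ _ _]]] := limit_closing id u.
by exists (oadd l k); [exists l|exact: lt_le_trans ul (oadd_ge _ _)].
Qed.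

(** The recursion only carries the supremum of the bounds met so far. *)
Lemma fast_sequence (S : set W) (B : W -> W) (u0 : W) :
  (forall u, exists2 x, S x & (u < x)%O) ->
  exists c : nat -> W, [/\ forall j, S (c j), forall j, (u0 < c j)%O
    & forall i j, (i < j)%N -> (B (c i) < c j)%O].
Proof.
move=> unb; have [|pick pickP] := @choice _ _ (fun u x => S x /\ (u < x)%O).
  by move=> u; have [x] := unb u; exists x.
(* m j dominates u0 and B (c i) for all i < j *)
pose m j := iter j (fun u => Order.max u (B (pick u))) u0.
have mD i j : (m i <= m (i + j)%N)%O.
  by elim: j => [|j IHj]; rewrite ?addn0// addnS /= le_max IHj.
exists (pick \o m); split => [j|j|i j ij] /=.
- by have [] := pickP (m j).
- by apply: le_lt_trans (pickP (m j)).2; exact: (mD 0%N j).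
- apply: le_lt_trans (pickP (m j)).2.
  by rewrite -(subnKC ij); apply: le_trans (mD _ _); rewrite /= le_max lexx orbT.
Qed.

Lemma cvg_from_below (g x : nat -> W) (l : W) : limit_ordinals l ->
  (forall y, (y < l)%O -> exists n, (y <= g n)%O) ->
  (forall n, (g n < x n)%O /\ (x n <= g n.+1)%O) -> (forall n, (g n < l)%O) ->
  x @ \oo --> l.
Proof.
move=> [[y0 y0l] _] gcof gx gl.
have gle i j : (g i <= g (i + j)%N)%O.
  elim: j => [|j IHj]; rewrite ?addn0// addnS (le_trans IHj)//.
  by have [h1 h2] := gx (i + j)%N; exact: le_trans (ltW h1) h2.
have ev y : (y < l)%O -> \forall n \near \oo, (y < x n)%O.
  move=> /gcof[N yN]; exists N => // n /= Nn.
  apply: le_lt_trans yN (le_lt_trans _ (gx n).1); rewrite -(subnKC Nn).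
  exact: gle.
have xl n : (x n < l)%O by exact: le_lt_trans (gx n).2 (gl _).
move=> V; rewrite itv_nbhsE => -[[a b] [io lab] abV].
suff: \forall n \near \oo, x n \in Interval a b by apply: filterS => n /abV.
have [y yl yab] : exists2 y, (y < l)%O & forall z, (y < z < l)%O -> z \in Interval a b.
  move: lab; rewrite itv_boundlr => /andP[al lb].
  have lb' z : (z < l)%O -> (BRight z <= b)%O.
    by move=> zl; apply: le_trans lb; rewrite bnd_simp ltW.
  case: a al io {abV} => [[] a|[]] al io.
  - by case: b io {lb lb'} => [[]?|[]].
  - exists a => // z /andP[az zl]; by rewrite itv_boundlr lb'// bnd_simp az.
  - exists y0 => // z /andP[az zl]; by rewrite itv_boundlr lb'.
  - by [].
by apply: filterS (ev _ yl) => n yx; apply: yab; rewrite yx xl.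
Qed.

Lemma countable_le (u : W) : countable [set x | (x <= u)%O].
Proof.
case: hW => _ _ /(_ u)/(countableU1 u); apply: sub_countable.
by apply: subset_card_le => x /=; rewrite le_eqVlt => /orP[/eqP|]; [right|left].
Qed.

(** Initial segments are countable, so a family of functions indexed by pairs of
    ordinals is dominated, at arguments and indices up to u, by one B u, as in
    diagonal intersections of closed unbounded sets. *)
Lemma diagonal_bound (Phi : (bool -> W) -> W -> W) : exists B : W -> W,
  forall u, (u < B u)%O /\
    forall x a, (forall e, (x e <= u)%O) -> (a <= u)%O -> (Phi x a < B u)%O.
Proof.
suff /choice[B BP] : forall u : W, exists b, (u < b)%O /\
    forall x a, (forall e, (x e <= u)%O) -> (a <= u)%O -> (Phi x a < b)%O.
  by exists B.
move=> u; pose D := [set x | (x <= u)%O].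
pose h (t : W * W * W) := Phi (fun e => if e then t.1.1 else t.1.2) t.2.
have [|b hb] := @countable_bounded ((h @` (D `*` D `*` D)) `|` [set u]).
  apply: countableU1; apply: (@sub_countable _ _ _ (D `*` D `*` D)).
    exact: card_image_le.
  by do 2?apply: countableX; exact: countable_le.
exists b; split=> [|x a xu au]; first by apply: hb; right.
apply: hb; left; exists (x true, x false, a); first by do !split; rewrite /D /=.
by rewrite /h /=; congr (Phi _ a); apply/funext => -[].
Qed.

(** * Forced values

    A pair of sequences is a map q from bool, and its prefixes of length k are
    represented by pairs of which only the coordinates below k matter. *)

Definition nonlimits (q : bool -> nat -> W) : Prop :=
  forall e j, ~ limit_ordinals (q e j).

Definition agree k (p q : bool -> nat -> W) : Prop :=
  forall e j, (j < k)%N -> q e j = p e j.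

(** Each coordinate from the k-th on exceeds the phi-images of all earlier
    coordinates of both members. *)
Definition fast (phi : W -> W) k (q : bool -> nat -> W) : Prop :=
  forall e e' i j, (i < j)%N -> (k <= j)%N -> (phi (q e i) < q e' j)%O.

Definition forces (E : (bool -> nat -> W) -> bool) v k p : Prop :=
  exists phi, forall q, agree k p q -> nonlimits q -> fast phi k q -> E q = v.

Definition decided E k p : Prop := exists v, forces E v k p.

(** Continuity of E along sequences in Z * Z.  A single index n with the limit
    value is enough: applied to sequences that avoid the limit value, it gives
    the usual form. *)
Definition seq_continuous (E : (bool -> nat -> W) -> bool) : Prop :=
  forall (u : nat -> bool -> nat -> W) (a : bool -> nat -> W),
    (forall n e, Kulesza W (u n e)) -> (forall e, Kulesza W (a e)) ->
    (forall e j, (fun n => u n e j) @ \oo --> a e j) ->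
  exists n, E (u n) = E a.

(** p below k, then x at k, then c; both members share the tail c. *)
Definition splice (p : bool -> nat -> W) k (x : bool -> W) (c : nat -> W) :
    bool -> nat -> W :=
  fun e j => if (j < k)%N then p e j else if j == k then x e else c (j - k.+1)%N.

Lemma splice_lt p k x c e j : (j < k)%N -> splice p k x c e j = p e j.
Proof. by rewrite /splice => ->. Qed.

Lemma splice_eq p k x c e : splice p k x c e k = x e.
Proof. by rewrite /splice ltnn eqxx. Qed.

Lemma splice_gt p k x c e i : splice p k x c e (k.+1 + i)%N = c i.
Proof.
rewrite /splice ltnNge (leq_trans (leqnSn k) (leq_addr _ _)) /=.
by rewrite gtn_eqF ?leq_addr// addKn.
Qed.

Lemma splice_elim (P : nat -> W -> Prop) p k x c e :
  (forall j, (j < k)%N -> P j (p e j)) -> P k (x e) ->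
  (forall i, P (k.+1 + i)%N (c i)) -> forall j, P j (splice p k x c e j).
Proof.
move=> Pp Px Pc j; case: (ltngtP j k) => [jk|kj|->].
- by rewrite splice_lt//; exact: Pp.
- by rewrite -(subnKC kj) splice_gt; exact: Pc.
- by rewrite splice_eq.
Qed.

Lemma Kulesza_nonlimit (a : nat -> W) : (forall j, ~ limit_ordinals (a j)) ->
  Kulesza W a.
Proof. by move=> na; split => // [j k /na|k /na]. Qed.

Lemma Kulesza_splice p k l c e : (0 < k)%N ->
  (forall j, (j < k)%N -> ~ limit_ordinals (p e j)) -> limit_ordinals l ->
  c 0%N = oadd l k -> (forall i, limit_plus k (c i)) ->
  Kulesza W (splice p k (fun=> l) c e).
Proof.
move=> k0 np Ll c0 cS.
have nc i : ~ limit_ordinals (c i) by exact: limit_plus_nonlimit (cS i).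
have onlyk : forall j, limit_ordinals (splice p k (fun=> l) c e j) -> j = k.
  apply: (splice_elim (P := fun j y => limit_ordinals y -> j = k)) => //.
  - by move=> j /np.
  - by move=> i /nc.
split.
- by rewrite splice_lt//; exact: np.
- by move=> i j /onlyk -> /onlyk ->.
move=> j /onlyk ->; split.
  by rewrite -[k.+1 in LHS]addn0 splice_gt c0 splice_eq.
move=> [|[|i]] // _.
by rewrite addnS -addSn splice_gt.
Qed.

Lemma agree_splice p k x c : agree k p (splice p k x c).
Proof. by move=> e j; exact: splice_lt. Qed.

(** The argument at a limit point of Z: all the pairs with x at k, for x below a
    suitable limit l, are continued by one common fast tail starting with l + k,
    and these pairs converge to the pair with l at k. *)
Lemma decided_step E k p : seq_continuous E -> (0 < k)%N ->
  (forall e j, (j < k)%N -> ~ limit_ordinals (p e j)) ->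
  (forall q, agree k p q -> (forall e, ~ limit_ordinals (q e k)) ->
     decided E k.+1 q) ->
  decided E k p.
Proof.
move=> Ec k0 np dS; apply: contrapT => undecided.
pose ext x := splice p k x (fun=> x true).
have /choice[V /choice[Phi PhiP]] : forall x : bool -> W, exists v, exists phi,
    (forall e, ~ limit_ordinals (x e)) ->
    forall q, agree k.+1 (ext x) q -> nonlimits q -> fast phi k.+1 q -> E q = v.
  move=> x; have [nx|nnx] := pselect (forall e, ~ limit_ordinals (x e)); last first.
    by exists true, id.
  have [||v [phi phiP]] := dS (ext x); first exact: agree_splice.
    by move=> e; rewrite /ext splice_eq.
  by exists v, phi.
have [B BP] := diagonal_bound Phi.
(* If all large x had the value v, the function u |-> max g (B u) would force v
   at k; so each value is avoided beyond each g. *)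
have /choice[X /all_and2[Xnonlim XP]] : forall vg : bool * W, exists x : bool -> W,
    (forall e, ~ limit_ordinals (x e)) /\
    ((forall e, (vg.2 < x e)%O) /\ V x = ~~ vg.1).
  move=> [v g] /=; apply: contrapT => noX; apply: undecided; exists v.
  exists (fun u => Order.max g (B u)) => q pq nq fq.
  pose x e := q e k.
  (* the coordinate 0 < k is below x, which makes g a bound for x *)
  have gx e : (g < x e)%O.
    by have := fq e e 0%N k k0 (leqnn k); rewrite gt_max => /andP[].
  have -> : v = V x.
    apply: contrapT => vV; apply: noX; exists x; split; first by move=> e; exact: nq.
    by split=> //; move: vV; case: (v) (V x) => -[].
  apply: PhiP => //; first by move=> e; exact: nq.
    move=> e j; rewrite ltnS leq_eqVlt => /orP[/eqP ->|jk].
      by rewrite /ext splice_eq.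
    by rewrite /ext splice_lt// pq.
  move=> e e' i j ij kj.
  have [m [mj mi mx]] : exists m, [/\ (B m < q e' j)%O, (q e i <= m)%O &
      forall e, (x e <= m)%O].
    have step e1 i1 : (i1 < j)%N -> (B (q e1 i1) < q e' j)%O.
      move=> i1j; have := fq e1 e' i1 j i1j (ltnW kj).
      by rewrite gt_max => /andP[].
    pose m := Order.max (q e i) (Order.max (x true) (x false)).
    exists m; split.
    - by rewrite /m /x /Order.max; do ?[case: ifP => _]; exact: step.
    - by rewrite le_max lexx.
    - by move=> -[]; rewrite !le_max lexx ?orbT.
  by apply: lt_trans mj; apply: (BP m).2.
have XB u : exists b, forall v e, (X (v, u) e < b)%O.
  have [b bP] := countable_ubound (fun ve : bool * bool => X (ve.1, u) ve.2).
  by exists b => v e; exact: (bP (v, e)).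
have {XB}[XB XBP] := choice XB.
have [pb pbP] := countable_ubound (fun ej : bool * nat => p ej.1 ej.2).
pose Psi u := Order.max (XB u) (Order.max (B u) pb).
have [g [l [Ll _ gPsi gl gcof]]] := limit_closing Psi pb.
have [|t [tS tgt tfast]] := fast_sequence B (B (oadd l k)) (S := limit_plus k).
  exact: limit_plus_unbounded.
pose c i := if i is i'.+1 then t i' else oadd l k.
have cL i : limit_plus k (c i) by case: i => [|i]; [exists l|exact: tS].
pose a := splice p k (fun=> l) c.
have aZ e : Kulesza W (a e) by apply: Kulesza_splice => // j; exact: np.
(* v is the value at the limit, and u n avoids it for every n *)
pose v := E a.
pose u n := splice p k (X (v, g n)) c.
have unl n : nonlimits (u n).
  move=> e; apply: (splice_elim (P := fun _ y => ~ limit_ordinals y)).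
  - by move=> j; exact: np.
  - exact: Xnonlim.
  - by move=> i; exact: limit_plus_nonlimit (cL i).
have Xg n e : (g n < X (v, g n) e)%O by case: (XP (v, g n)).
have XgS n e : (X (v, g n) e <= g n.+1)%O.
  by apply: ltW; apply: lt_le_trans (gPsi n); rewrite /Psi lt_max XBP.
have BgS n : (B (g n) <= g n.+1)%O.
  by apply: le_trans (gPsi n); rewrite /Psi !le_max lexx !orbT.
have [n En] : exists n, E (u n) = E a.
  apply: Ec => // [n e|e].
    by apply: Kulesza_nonlimit => j; exact: unl.
  apply: (@splice_elim (fun j y => u ^~ e ^~ j @ \oo --> y)).
  - move=> j jk; rewrite (_ : u ^~ e ^~ j = fun=> p e j); first exact: cvg_cst.
    by apply/funext => n; rewrite /u splice_lt.
  - rewrite (_ : u ^~ e ^~ k = fun n => X (v, g n) e).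
      apply: (cvg_from_below Ll gcof _ gl) => n'.
      exact: (conj (Xg n' e) (XgS n' e)).
    by apply/funext => n; rewrite /u splice_eq.
  - move=> i; rewrite (_ : u ^~ e ^~ (k.+1 + i)%N = fun=> c i).
      exact: cvg_cst.
    by apply/funext => n; rewrite /u splice_gt.
suff : E (u n) = V (X (v, g n)) by rewrite (XP _).2 En /= /v; case: (E a).
apply: PhiP; [by move=> e; exact: Xnonlim| | exact: unl|].
  move=> e j; rewrite ltnS leq_eqVlt => /orP[/eqP ->|jk].
    by rewrite /ext /u !splice_eq.
  by rewrite /ext /u !splice_lt.
have small e i : (i <= k)%N -> (u n e i <= g n.+1)%O.
  rewrite leq_eqVlt => /orP[/eqP ->|ik]; first by rewrite /u splice_eq.
  rewrite /u splice_lt//; apply: le_trans (gPsi n).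
  by rewrite /Psi !le_max (ltW (pbP (e, i))) !orbT.
have lk : (l <= oadd l k)%O by exact: oadd_ge.
move=> e e' i j ij kj.
(* m dominates the argument and the coordinates at k, while B m is below the
   coordinate at j: m is g n.+1 if j = k.+1, and l + k or an element of the tail
   otherwise *)
have [m [mi mX mj]] : exists m, [/\ (u n e i <= m)%O,
    forall e, (X (v, g n) e <= m)%O & (B m < u n e' j)%O].
  have uS e1 i1 : u n e1 (k.+1 + i1)%N = c i1 by rewrite /u splice_gt.
  move: ij; rewrite -(subnKC kj) uS; case: (j - k.+1)%N => [|j'].
    rewrite addn0 ltnS => ik; exists (g n.+1); split => //; first exact: small.
    by apply: le_lt_trans (lt_le_trans (gl n.+2) lk); exact: BgS.
  have Xl e1 : (X (v, g n) e1 <= oadd l k)%O.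
    by apply: le_trans (XgS n e1) (le_trans (ltW (gl _)) lk).
  have [ik _|ki] := leqP i k.
    exists (oadd l k); split => //; last exact: tgt.
    by apply: le_trans (small e i ik) (le_trans (ltW (gl _)) lk).
  rewrite -(subnKC ki) ltn_add2l uS; case: (i - k.+1)%N => [_|i' ij'].
    by exists (oadd l k); split => //; exact: tgt.
  exists (t i'); split => //; last exact: tfast.
  move=> e1; apply: le_trans (Xl e1) _.
  by apply: ltW; apply: lt_trans (BP _).1 (tgt _).
by apply: lt_trans mj; apply: (BP m).2.
Qed.

(** Otherwise there would be pairs that avoid the value E z and agree with z on
    longer and longer prefixes, hence converge to z. *)
Lemma locally_constant E z : seq_continuous E -> nonlimits z ->
  exists k, forall q, agree k z q -> nonlimits q -> E q = E z.
Proof.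
move=> Ec nz; apply: contrapT => nk.
have /choice[u uP] : forall k, exists q, [/\ agree k z q, nonlimits q & E q <> E z].
  move=> k; apply: contrapT => nq; apply: nk; exists k => q zq nlq.
  by apply: contrapT => Eq; apply: nq; exists q.
have [n e|e|e j|n] := Ec u z; last by case: (uP n).
- by apply: Kulesza_nonlimit; case: (uP n).
- exact: Kulesza_nonlimit.
- apply: cvg_near_cst; exists j.+1 => // n /= jn.
  by case: (uP n) => ->.
Qed.

Lemma decided_agree E k p q : agree k p q -> decided E k p -> decided E k q.
Proof.
move=> pq [v [phi phiP]]; exists v, phi => r qr; apply: phiP => e j jk.
by rewrite qr// pq.
Qed.

(** An undecided prefix would grow, by decided_step, to an infinite pair with
    undecided prefixes only, against locally_constant. *)
Lemma nonlimit_decided E k p : seq_continuous E -> (0 < k)%N ->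
  (forall e j, (j < k)%N -> ~ limit_ordinals (p e j)) -> decided E k p.
Proof.
move=> Ec k0 np; apply: contrapT => und.
pose bad k p := [/\ (0 < k)%N, forall e j, (j < k)%N -> ~ limit_ordinals (p e j)
  & ~ decided E k p].
have /choice[F FP] : forall kp : nat * (bool -> nat -> W), exists q,
    bad kp.1 kp.2 -> agree kp.1 kp.2 q /\ bad kp.1.+1 q.
  move=> [i r] /=; have [[i0 nr undr]|] := pselect (bad i r); last by exists r.
  apply: contrapT => nq; apply: undr; apply: decided_step => // q rq nq'.
  apply: contrapT => undq; apply: nq; exists q => _; split => //; split => //.
  move=> e j; rewrite ltnS leq_eqVlt => /orP[/eqP ->|ji]; first exact: nq'.
  by rewrite rq//; exact: nr.
(* P n is correct below k + n, so z takes its coordinate j from P j.+1 *)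
pose P := fix P n := if n is n'.+1 then F ((k + n')%N, P n') else p.
have badP n : bad (k + n)%N (P n).
  elim: n => [|n IHn]; first by rewrite addn0.
  by rewrite addnS; case: (FP (k + n, P n)%N IHn).
have agP n m : agree (k + n) (P n) (P (n + m)%N).
  elim: m => [|m IHm] e j jn; first by rewrite addn0.
  rewrite addnS -IHm//; apply: (FP (k + (n + m), P (n + m))%N (badP _)).1.
  by apply: leq_trans jn _; rewrite leq_add2l leq_addr.
pose z e j := P j.+1 e j.
have agz n : agree (k + n) z (P n).
  move=> e j jn; rewrite /z.
  rewrite -(agP n j.+1)// [in LHS]addnC -[RHS](agP _ n)//.
  by rewrite addnS ltnS leq_addl.
have nz : nonlimits z.
  by move=> e j; case: (badP j.+1) => _ + _; apply; rewrite addnS ltnS leq_addl.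
have [n nP] := locally_constant Ec nz.
case: (badP n) => _ _; apply; apply: (decided_agree (agz n)).
exists (E z), id => q zq nq _; apply: nP => // e j jn; apply: zq.
exact: leq_trans jn (leq_addl _ _).
Qed.

(** The pair consists of a0 c_0 c_2 c_3 ... and a0 c_1 c_2 c_3 ... for one fast
    sequence c. *)
Lemma diagonal_not_clopen_intersection (E : nat -> (bool -> nat -> W) -> bool) :
  (forall n, seq_continuous (E n)) ->
  (forall n a, Kulesza W a -> E n (fun=> a)) ->
  exists a b, [/\ Kulesza W a, Kulesza W b, a <> b
    & forall n, E n (fun e => if e then a else b)].
Proof.
move=> Ec Ediag.
have [w _] : exists w : W, True.
  apply: contrapT => nw; case: hW => _ + _; apply.
  rewrite (_ : setT = set0) ?countable0//.
  by apply/seteqP; split => // w _; apply: nw; exists w.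
pose a0 := osucc w; pose p (_ : bool) (_ : nat) := a0.
have na0 : ~ limit_ordinals a0 by exact: osucc_nonlimit.
have nonlim_unb (u : W) : exists2 x : W, ~ limit_ordinals x & (u < x)%O.
  by exists (osucc u); [exact: osucc_nonlimit|exact: osucc_gt].
have /choice[v /choice[phi phiP]] : forall n, exists v, exists phi, forall q,
    agree 1 p q -> nonlimits q -> fast phi 1 q -> E n q = v.
  move=> n; apply: (@nonlimit_decided (E n)) => // e j _; exact: na0.
have /choice[B BP] : forall u, exists b, forall n, (phi n u < b)%O.
  by move=> u; exact: countable_ubound.
(* taking the maximum with u makes c increasing, so that c 0 <> c 1 *)
have [c [cn ca cfast]] :=
  fast_sequence (fun u => Order.max u (B u)) (B a0) nonlim_unb.
have cB i j : (i < j)%N -> (B (c i) < c j)%O.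
  by move=> /cfast; rewrite gt_max => /andP[].
pose path i j := if j is j'.+1 then c (if j' is 0 then i else j) else a0.
have pathE n (i : bool -> nat) : (forall e, i e < 2)%N ->
    E n (fun e => path (i e)) = v n.
  move=> i2; apply: phiP => [e [|]//|e [|j]//|e e' i1 j]; first exact: cn.
  case: j => // j ij _; apply: lt_trans (BP _ _) _.
  case: i1 ij => [_|i1 ij]; first exact: ca.
  case: j ij => // j ij; apply: cB.
  by case: i1 ij => // _; apply: leq_trans (i2 e) _.
exists (path 0), (path 1); split.
- by apply: Kulesza_nonlimit => -[|j] //; exact: cn.
- by apply: Kulesza_nonlimit => -[|j] //; exact: cn.
- move=> /(congr1 (@^~ 1)) /= c01; have := cfast 0 1 isT.
  by rewrite c01 gt_max ltxx.
(* the diagonal pair is fast as well, which identifies the forced value *)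
move=> n; have vn : v n.
  rewrite -(pathE n (fun=> 0)) //; apply: Ediag; apply: Kulesza_nonlimit => -[|j] //.
  exact: cn.
rewrite (_ : (fun e => _) = (fun e : bool => path (if e then 0 else 1))).
  by rewrite pathE // => -[].
by apply/funext => -[].
Qed.

End Omega1.

(** * Clopen sets in the group *)

Lemma cvg_clopen (T : topologicalType) (V : set T) (u : nat -> T) (a : T) :
  clopen V -> u @ \oo --> a -> exists n, `[< V (u n) >] = `[< V a >].
Proof.
move=> [Vo Vc] ua; have [Va|nVa] := pselect (V a).
  have [N _ VN] := ua _ (open_nbhs_nbhs (conj Vo Va)).
  by exists N; rewrite !asboolT//; exact: VN (leqnn N).
have oVC : open (~` V) by rewrite openC.
have [N _ VN] := ua _ (open_nbhs_nbhs (conj oVC nVa)).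
by exists N; rewrite !asboolF//; exact: VN (leqnn N).
Qed.

Lemma clopen_basis (X : topologicalType) (x : X) (U : set X) : ind_lt 1 X ->
  nbhs x U -> exists V : set X, [/\ clopen V, V x & V `<=` U].
Proof.
move=> indX; rewrite nbhsE => -[U1 [U1o U1x] U1U].
have [V [Vo Vx VU1 bdV]] := indX x U1 U1o U1x.
exists V; split=> //; last exact: subset_trans U1U.
split=> //; rewrite closure_id; apply/seteqP; split; first exact: subset_closure.
move=> y cVy; apply: contrapT => nVy.
have bVy : y \in boundary V by rewrite inE; split => // /interior_subset.
by have : set0 (SigSub bVy) by rewrite -bdV.
Qed.

Lemma point_clopen_intersection (R : realType) (X : topologicalType) (x : X) :
  metrizable R X -> ind_lt 1 X ->
  exists V : nat -> set X, [/\ forall n, clopen (V n), forall n, V n x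
    & forall y, (forall n, V n y) -> y = x].
Proof.
move=> [dist [dist0 distC distT distnbhs]] indX.
have /choice[V /all_and3[clV Vx VU]] : forall n : nat, exists V : set X,
    [/\ clopen V, V x & V `<=` [set y | dist x y < n.+1%:R^-1]%R].
  move=> n; apply: clopen_basis => //; apply/distnbhs.
  by exists n.+1%:R^-1%R => //; rewrite invr_gt0 ltr0Sn.
exists V; split => // y Vy; apply/esym/dist0/eqP; rewrite eq_le; apply/andP; split.
  rewrite leNgt; apply/negP => d0.
  have [n _ /(_ n (leqnn n))] := near_infty_natSinv_lt (PosNum d0).
  by rewrite /= ltNge => /negP; apply; apply: ltW (VU n y (Vy n)).
by have := distT x y x; rewrite (distC y x) (proj2 (dist0 x x) erefl) -mulr2n pmulrn_lge0.
Qed.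

Theorem mainTheorem3 (R : realType) (d : Order.disp_t)
    (W : orderTopologicalType d) (hW : is_omega1 W)
    (G : topologicalGroupType) (hG : metrizable R G) (indG : ind_eq G 0) :
  ~ exists f : set_type (Kulesza W) -> G, embedding f.
Proof.
move=> [f [finj fcont _]].
have [V [clV V1 Vcap]] := point_clopen_intersection (1%g : G) hG indG.1.
pose g a := if pselect (Kulesza W a) is left Za then f (SigSub (mem_set Za)) else 1%g.
have gE a (Za : Kulesza W a) : g a = f (SigSub (mem_set Za)).
  by rewrite /g; case: pselect => // Za'; congr f; exact: val_inj.
have gcvg (u : nat -> nat -> W) a : (forall n, Kulesza W (u n)) -> Kulesza W a ->
    (forall j, u ^~ j @ \oo --> a j) -> g \o u @ \oo --> g a.
  move=> Zu Za ua; pose w n : set_type (Kulesza W) := SigSub (mem_set (Zu n)).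
  have wa : w @ \oo --> (SigSub (mem_set Za) : set_type (Kulesza W)).
    by apply: cvg_set_type; exact: cvg_ptws.
  rewrite (gE _ Za) (_ : g \o u = f \o w); first exact: cvg_comp wa (fcont _).
  by apply/funext => n; rewrite /comp (gE _ (Zu n)).
pose E n (q : bool -> nat -> W) := `[< V n ((g (q true))^-1 * g (q false))%g >].
have [||a [b [Za Zb ab Eab]]] := @diagonal_not_clopen_intersection _ W hW E.
- move=> n u a Zu Za ua.
  apply: (cvg_clopen (u := fun i => ((g (u i true))^-1 * g (u i false))%g)) => //.
  have gu e : g \o (u ^~ e) @ \oo --> g (a e) by exact: gcvg.
  have gV := cvg_comp _ _ (gu true) (@invg_continuous G _).
  exact: (cvg_comp _ _ (cvg_pair gV (gu false)) (@mulg_continuous G (_, _))).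
- by move=> n a Za; rewrite /E mulVg; apply/asboolP.
apply: ab; have /Vcap : forall n, V n ((g a)^-1 * g b)%g.
  by move=> n; exact/asboolP/(Eab n).
move=> /(congr1 (fun x => g a * x)%g); rewrite mulVKg mulg1 (gE _ Za) (gE _ Zb).
by move=> /finj /(congr1 val).
Qed.
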